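(* Let $k,h\in\mathbb{N}$ with $k\ge1$, $h>1$. Let $A=\{a_n\}$ and $B=\{b_n\}$ be infinite sets of natural numbers (enumerated increasingly), and let $$l=\liminf_{n,m\to\infty}\frac{a_n+b_m}{n\sqrt[k]{m}}.$$ If $l<\frac{1}{\sqrt[k]{h-1}}$ then $R_k^h(A)\cap[B]^h\ne\emptyset$; and if $l=0$ then $R_k^h(A)\cap[B]^h$ is infinite for every $h>1$.
   Context: Natural numbers are positive integers; $A=\{a_n\}$ means $a_1<a_2<\ldots$. For a double sequence, $\liminf_{n,m\to\infty}c_{nm}=\lim_{j\to\infty}\left(\inf_{n,m\ge j}c_{nm}\right)$. For $A\subseteq\mathbb{N}$, $A+x=\{a+x\mid a\in A\}$. $[X]^h$ is the family of subsets of $X$ of cardinality $h$. For $h>1$, $R_k^h(A)=\{\{t_1<\ldots<t_h\}\in[\mathbb{N}]^h \mid |(A+t_1)\cap\ldots\cap(A+t_h)|\ge k\}$. *)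

(* Defs.v *)
From HB Require Import structures.
From mathcomp Require Import all_boot all_order all_algebra.
From mathcomp Require Import all_classical all_reals all_analysis.
Set Implicit Arguments.
Unset Strict Implicit.
Unset Printing Implicit Defensive.
Import Order.TTheory GRing.Theory Num.Theory.
Local Open Scope classical_set_scope.
Local Open Scope card_scope.
Local Open Scope ring_scope.

(* The natural numbers start at 1. *)
Definition posnat : set nat := [set n | (0 < n)%N].

(* Enumerations are indexed from 1; the value [a 0] is never used. *)
Definition increasing_enum (A : set nat) (a : nat -> nat) : Prop :=
  (forall n m : nat, (0 < n)%N -> (n < m)%N -> (a n < a m)%N) /\
  [set a n | n in posnat] = A.

Definition shift_set (A : set nat) (x : nat) : set nat :=
  [set (a + x)%N | a in A].

(* [X]^h *)
Definition subsets_of_card (X : set nat) (h : nat) : set (set nat) :=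
  [set T | T `<=` X /\ T #= `I_h].

(* The intersection of shifts may be infinite, so "at least k elements" is
   expressed by an injection of {0, ..., k-1}. *)
Definition Rset (k h : nat) (A : set nat) : set (set nat) :=
  [set T | subsets_of_card posnat h T /\
           `I_k #<= \bigcap_(t in T) shift_set A t].

(* Extended-real valued, as the limit may be +oo; terms with [n = 0] or [m = 0]
   occur only at [j = 0], which does not affect the limit. *)
Definition dbl_liminf (R : realType) (c : nat -> nat -> R) : \bar R :=
  limn (fun j : nat =>
    ereal_inf [set x : \bar R | exists n m : nat,
                 [/\ (j <= n)%N, (j <= m)%N & x = (c n m)%:E]]).

Definition root_nat (R : realType) (k : nat) (x : R) : R := x `^ (k%:R^-1).

(* Main.v *)
Require Import Defs.
From HB Require Import structures.
From mathcomp Require Import all_boot all_order all_algebra.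
From mathcomp Require Import ring lra zify.
From mathcomp Require Import all_classical all_reals all_analysis.
Set Implicit Arguments.
Unset Strict Implicit.
Unset Printing Implicit Defensive.
Import Order.TTheory GRing.Theory Num.Theory.

(** Put [N = a n + b m].  The [m] sets [{a j + b i | j <= n}], [i <= m], are
    [n]-subsets of [{1, ..., N}].  As soon as [(h - 1) * 'C(N, k) < m * 'C(n, k)],
    the pigeonhole principle over the [k]-subsets of [{1, ..., N}] gives one that lies
    in [h] of these sets.  For large [n], [m] that inequality amounts to
    [N / (n * m^(1/k)) < (h - 1)^(-1/k)].  If [l = 0], this applies to every [h]: were
    the solutions of size [h'] finitely many, with finite union [u], a solution of
    size [h' + |u| + 1] would have an element outside [u], hence an [h']-subset not
    included in [u]. *)

(** Double counting of the pairs [(i, K)] with [#|K| = k] and [K \subset S i]. Each [i] contributes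
    at least ['C(n, k)] of them; if every [K] lay in at most [h] of the sets, there would be at most
    [h * 'C(#|T|, k)]. *)
Lemma common_subset_pigeonhole (T I : finType) (S : I -> {set T}) (n k h : nat)
    (cardS : forall i, n <= #|S i|)
    (lt_count : h * 'C(#|T|, k) < #|I| * 'C(n, k)) :
  exists (J : {set I}) (K : {set T}),
    [/\ #|J| = h.+1, #|K| = k & forall i, i \in J -> K \subset S i].
Proof.
have [K /andP[/eqP cK hK]|noK] :=
  pickP (fun K : {set T} => (#|K| == k) && (h < #|[set i | K \subset S i]|)).
  have [J sJ cJ] : exists2 J : {set I},
      J \subset [set i | K \subset S i] & #|J| = h.+1.
    have : 0 < #|[set J : {set I} |
        (J \subset [set i | K \subset S i]) & (#|J| == h.+1)]|.
      by rewrite cards_draws bin_gt0.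
    by case/card_gt0P => J; rewrite inE => /andP[sJ /eqP cJ]; exists J.
  exists J, K; split=> // i iJ.
  by move/fintype.subsetP: sJ => /(_ i iJ); rewrite inE.
move: lt_count; rewrite ltnNge; case/negP.
have -> : #|I| * 'C(n, k) = \sum_(i : I) 'C(n, k) by rewrite sum_nat_const.
apply: (@leq_trans (\sum_(i : I) \sum_(K : {set T} | #|K| == k) (K \subset S i))).
  apply: leq_sum => i _; apply: (leq_trans (leq_bin2l k (cardS i))).
  rewrite -cards_draws -sum1_card big_mkcond [leqRHS]big_mkcond /=.
  by apply: leq_sum => K _; rewrite inE; case: (K \subset _); case: (#|K| == k).
rewrite exchange_big /= -card_draws mulnC -sum_nat_const.
rewrite [leqRHS](eq_bigl (fun K : {set T} => #|K| == k)); last by move=> K; rewrite inE.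
apply: leq_sum => K cK; have := noK K; rewrite cK /= => /negbT.
rewrite -leqNgt -sum1dep_card big_mkcond /= => /(leq_trans _); apply.
by apply: leq_sum => i _; case: (_ \subset _).
Qed.

Local Open Scope classical_set_scope.
Local Open Scope ring_scope.

Lemma root_natX (R : realType) (k : nat) (x : R) :
  (0 < k)%N -> 0 <= x -> root_nat k x ^+ k = x.
Proof.
move=> k0 x0; rewrite /root_nat -powR_mulrn ?powR_ge0// -powRrM mulVf ?powRr1//.
by rewrite pnatr_eq0 -lt0n.
Qed.

(** The tail infima are nondecreasing in [j], so their limit is their supremum and bounds each of
    them from above. *)
Lemma dbl_liminf_lt (R : realType) (c : nat -> nat -> R) (x : \bar R) (j : nat) :
  (dbl_liminf c < x)%E ->
  exists n m, [/\ (j <= n)%N, (j <= m)%N & ((c n m)%:E < x)%E].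
Proof.
rewrite /dbl_liminf; set u := fun j => _ => ltx.
have ndu : {homo u : p q / (p <= q)%N >-> (p <= q)%E}.
  move=> p q pq; apply: ereal_inf_le_tmp => _ [n [m [qn qm ->]]].
  by exists n, m; split=> //; apply: leq_trans pq _.
have : (u j < x)%E.
  apply: le_lt_trans ltx; rewrite (cvg_lim _ (ereal_nondecreasing_cvgn ndu))//.
  by apply: ereal_sup_ubound; exists j.
by case/ereal_inf_lt => _ [n [m [jn jm ->]]] ?; exists n, m.
Qed.

Lemma leq_ffact_exp (n k : nat) : (n ^_ k <= n ^ k)%N.
Proof.
rewrite ffact_prod -[k in leqRHS]card_ord -prod_nat_const.
by apply: leq_prod => i _; apply: leq_subr.
Qed.

Lemma leq_exp_ffact (n k : nat) : ((n - k) ^ k <= n ^_ k)%N.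
Proof.
rewrite ffact_prod -[k in leqLHS]card_ord -prod_nat_const card_ord.
by apply: leq_prod => i _; apply: leq_sub2l; apply: ltnW.
Qed.

(** Multiplying by [k!] turns binomials into falling factorials. Since [N ^_ k <= N ^ k] and
    [(n - k) ^ k <= n ^_ k], it suffices to compare the [k]-th roots [g * N] and [r * (n - k)]; the
    last hypothesis says exactly that [c * g * n <= n - k]. *)
Lemma bin_ltn_of_root (R : realType) (k h n m N : nat) (c : R) :
  (0 < k <= n)%N -> N%:R < c * (n%:R * root_nat k m%:R) ->
  0 < root_nat k h%:R :> R -> k%:R <= (1 - c * root_nat k h%:R) * n%:R ->
  (h * 'C(N, k) < m * 'C(n, k))%N.
Proof.
case/andP => k0 kn; set r : R := root_nat k m%:R; set g : R := root_nat k h%:R.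
move=> ltN g0 lek.
rewrite -(ltn_pmul2r (fact_gt0 k)) -!mulnA !bin_ffact.
apply: (@leq_ltn_trans (h * N ^ k)%N); first by rewrite leq_mul2l leq_ffact_exp orbT.
apply: (@leq_trans (m * (n - k) ^ k)%N); last by rewrite leq_mul2l leq_exp_ffact orbT.
rewrite -(ltr_nat R) !natrM !natrX natrB//.
rewrite -[h%:R](@root_natX R k)// -[m%:R](@root_natX R k)// -!exprMn -/g -/r.
have r0 : 0 <= r by rewrite powR_ge0.
have : g * N%:R < r * (n%:R - k%:R).
  apply: (@lt_le_trans _ _ (g * (c * (n%:R * r)))); first by rewrite ltr_pM2l.
  have -> : g * (c * (n%:R * r)) = r * (c * g * n%:R) by ring.
  by apply: ler_wpM2l => //; lra.
by move=> lt; rewrite ltrXn2r ?mulr_ge0 ?powR_ge0 ?ler0n -?lt0n.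
Qed.

Local Open Scope card_scope.

Lemma card_eq_uniq (T : eqType) (s : seq T) : uniq s -> [set` s] #= `I_(size s).
Proof.
case: s => [|x0 s'] us; first by rewrite set_nil II0.
move: (x0 :: s') us => s us.
have -> : [set` s] = [set nth x0 s i | i in `I_(size s)].
  apply/seteqP; split=> [x /= xs|x /= [i si <-]]; last exact: mem_nth.
  by exists (index x s); [rewrite index_mem|exact: nth_index].
apply: inj_card_eq => i j; rewrite !inE /= => si sj /eqP.
by rewrite nth_uniq// => /eqP.
Qed.

Lemma seq_of_bin_ltn (A B : set nat) (a b : nat -> nat) (k h n m : nat) :
  A `<=` posnat -> B `<=` posnat -> increasing_enum A a -> increasing_enum B b ->
  (h * 'C(a n + b m, k) < m * 'C(n, k))%N ->
  exists s : seq nat, [/\ uniq s, size s = h.+1, [set` s] `<=` B &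
    `I_k #<= \bigcap_(t in [set` s]) shift_set A t].
Proof.
move=> Apos Bpos [incra rga] [incrb rgb] ltC.
(* Enumerations start at 1, so the ordinal [i] stands for the index [i.+1]. *)
have Aa i : A (a i.+1) by rewrite -rga; exists i.+1.
have Bb i : B (b i.+1) by rewrite -rgb; exists i.+1.
have leE c : (forall p q : nat, (0 < p)%N -> (p < q)%N -> (c p < c q)%N) ->
    forall N (i : 'I_N), (c i.+1 <= c N)%N.
  move=> incrc N i; have := ltn_ord i; rewrite leq_eqVlt => /orP[/eqP -> //|lt].
  by apply/ltnW/incrc.
have injE c : (forall p q : nat, (0 < p)%N -> (p < q)%N -> (c p < c q)%N) ->
    forall i j : nat, c i.+1 = c j.+1 -> i = j.
  move=> incrc i j eqc; case: (ltngtP i j) => // lt;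
    by move: lt; rewrite -ltnS => /(incrc _ _ (ltn0Sn _)); rewrite eqc ltnn.
(* The sums are at least 1, so taking predecessors loses nothing and places them in
   ['I_(a n + b m)]. *)
have flt (i : 'I_m) (j : 'I_n) : ((a j.+1 + b i.+1).-1 < a n + b m)%N.
  have := leE a incra n j; have := leE b incrb m i; have := Bpos _ (Bb i).
  rewrite /posnat /=; lia.
pose f i j := Ordinal (flt i j).
have finj i : injective (f i).
  move=> j1 j2 /(congr1 val) /= eqf; apply/val_inj/(injE a incra).
  have := Bpos _ (Bb i); rewrite /posnat /=; lia.
have [||J [K [cJ cK sub]]] := @common_subset_pigeonhole 'I_(a n + b m) 'I_m
    (fun i => f i @: [set: 'I_n])%SET n k h.
- by move=> i; rewrite card_imset// cardsT card_ord.
- by rewrite !card_ord.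
exists [seq b (nat_of_ord i).+1 | i <- enum J]; split.
- rewrite map_inj_uniq ?enum_uniq// => i j eqb; exact/val_inj/(injE b incrb).
- by rewrite size_map -cardE.
- by move=> _ /mapP[i _ ->]; exact: Bb.
(* Undoing the predecessor: each entry of [r] has the form [a j.+1 + b i.+1] for every [i] in [J],
   so it lies in all the shifts. *)
- pose r := [seq (nat_of_ord x).+1 | x <- enum K].
  have -> : k = size r by rewrite size_map -cardE.
  have /(card_eq_uniq (T:=nat)) : uniq r.
    by rewrite map_inj_uniq ?enum_uniq// => x y [] /val_inj.
  move=> /card_le_eql <-; apply: subset_card_le => _ /mapP[x xK ->].
  move=> _ /mapP[i iJ ->]; rewrite mem_enum in iJ; rewrite mem_enum in xK.
  have /fintype.subsetP/(_ x xK)/imsetP[j _ ->] := sub i iJ.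
  by exists (a j.+1) => //=; have := Bpos _ (Bb i); rewrite /posnat /=; lia.
Qed.

(** Here [h] plays the role of [h - 1] in the theorem. *)
Lemma seq_of_liminf_lt (R : realType) (A B : set nat) (a b : nat -> nat) (k h : nat) :
  (0 < k)%N -> (0 < h)%N ->
  A `<=` posnat -> B `<=` posnat -> increasing_enum A a -> increasing_enum B b ->
  (dbl_liminf (fun n m => (a n + b m)%N%:R / (n%:R * root_nat k m%:R) : R)%R
     < (1 / root_nat k h%:R)%:E)%E ->
  exists s : seq nat, [/\ uniq s, size s = h.+1, [set` s] `<=` B &
    `I_k #<= \bigcap_(t in [set` s]) shift_set A t].
Proof.
move=> k0 h0 Apos Bpos aA bB; set g : R := root_nat k h%:R => ltl.
have g0 : 0 < g by rewrite powR_gt0// ltr0n.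
(* A constant strictly below [1 / g] makes [1 - c * g] positive, so that [(1 - c * g) * n]
   eventually exceeds the fixed [k]. *)
have [c ltlc ltcg] : exists2 c : R,
    (dbl_liminf (fun n m => (a n + b m)%N%:R / (n%:R * root_nat k m%:R) : R)%R < c%:E)%E &
    c < 1 / g.
  move: ltl; case: (dbl_liminf _) => [l| |]//=; last first.
    by move=> _; exists (1 / g - 1); [exact: ltNyr|lra].
  rewrite lte_fin => ltl; exists ((l + 1 / g) / 2); [rewrite lte_fin|]; lra.
have cg1 : 0 < 1 - c * g by rewrite subr_gt0 -ltr_pdivlMr.
(* The first bound makes [n] and [m] positive and gives [k <= n]; the second gives
   [k <= (1 - c * g) * n]. *)
pose j := maxn k (Num.truncn (k%:R / (1 - c * g))).+1.
have [n [m [jn jm]]] := dbl_liminf_lt j ltlc.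
rewrite lte_fin => ltc.
have kn : (k <= n)%N by apply: leq_trans jn; rewrite leq_maxl.
have km : (k <= m)%N by apply: leq_trans jm; rewrite leq_maxl.
have nr0 : 0 < n%:R * root_nat k m%:R :> R.
  by rewrite mulr_gt0 ?powR_gt0 ?ltr0n//; lia.
rewrite ltr_pdivrMr// in ltc.
apply: (@seq_of_bin_ltn A B a b k h n m) => //.
apply: (bin_ltn_of_root (c := c)) => //; first by rewrite k0.
rewrite -/g mulrC -ler_pdivrMr//; apply/ltW.
apply: (lt_le_trans (truncnS_gt _)); rewrite ler_nat.
by apply: leq_trans jn; rewrite leq_maxr.
Qed.

(** Fewer translations can only enlarge the intersection, so a large solution may be cut down to any
    smaller size. *)
Lemma Rset_of_seq (A B : set nat) (k : nat) (s s' : seq nat) :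
  B `<=` posnat -> uniq s' -> {subset s' <= s} -> [set` s] `<=` B ->
  `I_k #<= \bigcap_(t in [set` s]) shift_set A t ->
  (Rset k (size s') A `&` subsets_of_card B (size s')) [set` s'].
Proof.
move=> Bpos us' ss' sB cap; have s'B : [set` s'] `<=` B by move=> t /ss' /sB.
have cs' := card_eq_uniq us'.
split; split=> //; first by split=> // t /s'B /Bpos.
apply: card_le_trans cap _; apply: subset_card_le => x capx t /ss'; exact: capx.
Qed.

Theorem theorem2p3 (R : realType) (k h : nat) (hk : (1 <= k)%N) (hh : (1 < h)%N)
  (A B : set nat) (a b : nat -> nat)
  (Apos : A `<=` posnat) (Bpos : B `<=` posnat)
  (Ainf : infinite_set A) (Binf : infinite_set B)
  (aA : increasing_enum A a) (bB : increasing_enum B b)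
  (l : \bar R)
  (hl : l = dbl_liminf (fun n m : nat =>
              (a n + b m)%N%:R / (n%:R * root_nat k m%:R))) :
  ((l < (1 / root_nat k (h%:R - 1))%:E)%E ->
     Rset k h A `&` subsets_of_card B h !=set0) /\
  (l = 0%E ->
     forall h' : nat, (1 < h')%N ->
       infinite_set (Rset k h' A `&` subsets_of_card B h')).
Proof.
split=> [ltl|l0 h' hh' Ffin].
  case: h hh ltl => [//|h1] h1_gt0; rewrite -natr1 addrK hl => ltl.
  have [s [us <- sB cap]] := seq_of_liminf_lt hk h1_gt0 Apos Bpos aA bB ltl.
  by exists [set` s]; exact: (Rset_of_seq Bpos us _ sB cap).
have /finite_seqP[u uE] : finite_set
    (\bigcup_(T in Rset k h' A `&` subsets_of_card B h') T).
  by apply: bigcup_finite => // T [_ [_ cT]]; apply/finite_setP; exists h'.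
pose H := (h' + size u)%N.
have H_gt0 : (0 < H)%N by rewrite /H; lia.
have [|s [us sizes sB cap]] := @seq_of_liminf_lt R A B a b k H hk H_gt0 Apos Bpos aA bB.
  by rewrite -hl l0 lte_fin divr_gt0// powR_gt0// ltr0n.
have [t ts tNu] : exists2 t, t \in s & t \notin u.
  apply/hasP; apply/negPn/negP => /hasPn su.
  have /(uniq_leq_size us) : {subset s <= u} by move=> x /su; rewrite negbK.
  by rewrite sizes /H; lia.
(* Removing [t] from [s] before choosing the other [h' - 1] elements keeps the entries distinct. *)
pose s' := t :: take h'.-1 (rem t s).
have sizes' : size s' = h'.
  by rewrite /= size_take size_rem// sizes /H; case: ifP; lia.
have us' : uniq s'.
  rewrite /= take_uniq ?rem_uniq// andbT; apply/negP => /mem_take.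
  by rewrite mem_rem_uniq// inE eqxx.
have ss' : {subset s' <= s}.
  by move=> x; rewrite inE => /orP[/eqP -> //|/mem_take/mem_rem].
have Ts' := Rset_of_seq Bpos us' ss' sB cap; rewrite sizes' in Ts'.
have : t \in u.
  suff : [set` u] t by [].
  by rewrite -uE; exists [set` s'] => //=; rewrite inE eqxx.
by rewrite (negbTE tNu).
Qed.
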